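(* Let $I_R(x)=\int_0^\infty e^{-xt}\,\dfrac{dt}{t(\pi^2+\log^2 t)}$ for $x>0$, and for integers $n\ge 0$ consider the function $$(-1)^n I_R^{(n)}(x)=\int_0^\infty e^{-xt}\,\frac{t^{n-1}}{\pi^2+\log^2 t}\,dt,\qquad x>0,$$ where $I_R^{(n)}$ is the $n$-th derivative of $I_R$. Then the following hold. (i) For every $n\ge 2$, $(-1)^n I_R^{(n)}(x)$ is strongly completely monotonic on $(0,\infty)$, but it is not a Stieltjes function. (ii) For $n=1$, $-I_R'(x)$ is neither strongly completely monotonic nor a Stieltjes function on $(0,\infty)$. (iii) For $n=0$, $I_R(x)$ is not strongly completely monotonic on $(0,\infty)$.
   Context: $\log^2 t$ means $(\log t)^2$. A function $f:(0,\infty)\to\mathbb{R}$ is strongly completely monotonic if it is infinitely differentiable and for every integer $k\ge 0$ the function $x\mapsto(-1)^k x^{k+1}f^{(k)}(x)$ is non-negative and strictly decreasing on $(0,\infty)$. A function $f:(0,\infty)\to[0,\infty)$ is a Stieltjes function if $f(x)=\frac{a}{x}+b+\int_{(0,\infty)}\frac{d\mu(t)}{x+t}$ for all $x>0$, with constants $a,b\ge 0$ and a non-negative Borel measure $\mu$ on $(0,\infty)$ with $\int_{(0,\infty)}\frac{d\mu(t)}{1+t}<\infty$. *)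

(* Defs.v *)
From HB Require Import structures.
From mathcomp Require Import all_boot all_order all_algebra.
From mathcomp Require Import all_classical all_reals all_analysis.

Set Implicit Arguments.
Unset Strict Implicit.
Unset Printing Implicit Defensive.

Import Order.TTheory GRing.Theory Num.Theory.
Import numFieldNormedType.Exports.

Local Open Scope ring_scope.
Local Open Scope classical_set_scope.

(* Functions on (0, +oo) are represented by total functions on R: the
   predicates below constrain them only at positive arguments, and the
   iterated derivatives at x > 0 depend only on the values on (0, +oo). *)

Definition strongly_completely_monotonic (R : realType) (f : R -> R) : Prop :=
  (forall (k : nat) (x : R), 0 < x -> derivable (derive1n k f) x 1) /\
  (forall k : nat,
     let g (x : R) := (-1) ^+ k * x ^+ k.+1 * derive1n k f x in
     (forall x : R, 0 < x -> 0 <= g x) /\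
     (forall x y : R, 0 < x -> x < y -> g y < g x)).

(* A Borel measure on (0, +oo) is represented by a Borel measure mu on R, of
   which only the restriction to (0, +oo) is used. *)
Definition stieltjes_function (R : realType) (f : R -> R) : Prop :=
  (forall x : R, 0 < x -> 0 <= f x) /\
  exists (a b : R) (mu : {measure set (measurableTypeR R) -> \bar R}),
    [/\ 0 <= a, 0 <= b,
        (\int[mu]_(t in `]0%R, +oo[) ((1 + t)^-1)%:E < +oo)%E
      & forall x : R, 0 < x ->
          ((f x)%:E = (a / x)%:E + b%:E +
                      \int[mu]_(t in `]0%R, +oo[) ((x + t)^-1)%:E)%E].

Definition I_R (R : realType) (x : R) : R :=
  (\int[@lebesgue_measure R]_(t in `]0%R, +oo[)
     (expR (- (x * t)) * (t * (pi ^+ 2 + ln t ^+ 2))^-1))%R.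

Definition I_R_sder (R : realType) (n : nat) (x : R) : R :=
  (-1) ^+ n * derive1n n (@I_R R) x.

(* Main.v *)
Require Import Defs.
From HB Require Import structures.
From mathcomp Require Import all_boot all_order all_algebra.
From mathcomp Require Import all_classical all_reals all_analysis.
From mathcomp Require Import measurable_realfun ring lra.

Set Implicit Arguments.
Unset Strict Implicit.
Unset Printing Implicit Defensive.

Import Order.TTheory GRing.Theory Num.Theory.
Import numFieldNormedType.Exports.

Local Open Scope ring_scope.
Local Open Scope classical_set_scope.

(** Write [L n x] for the integral over [t > 0] of [expR (- (x * t)) * t ^+ n]
    against the density [1 / (t * (pi ^+ 2 + ln t ^+ 2))] ([logLaplace] below).
    The primitive [atan (ln t / pi) / pi] shows that the density has mass at
    most 1 ([integral_logdens_le1]).  Since [expR (- (x * t)) * t ^+ n] is at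
    most [n`! / x ^+ n], a multiple of the density dominates every integrand,
    locally uniformly in [x]; differentiating under the integral, the
    derivative of [L n] is [- L n.+1], so [(-1) ^+ n] times the [n]-th
    derivative of [I_R] is [L n] ([is_derive_logLaplace], [derive1n_I_R]).

    For [n >= 2] the change of variables [s = x * t] turns
    [x ^+ k.+1 * L (n + k) x] into the integral over [s > 0] of
    [expR (- s) * s ^+ k * v (s / x)], where
    [v u = u ^+ n.-1 / (pi ^+ 2 + ln u ^+ 2)].  As [v] is strictly increasing
    ([lt_expr_logdens]), this is strictly decreasing in [x]
    ([lt_exprM_logLaplace]), which is strong complete monotonicity.

    If [f] is a Stieltjes function then [x * f x] is nondecreasing
    ([stieltjes_mul_nondecreasing]); for [n >= 2] this contradicts the strict
    decrease of [x * L n x].  For [n = 1], put [c = L 1 1 > 0].  If [x * L 1 x]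
    were nondecreasing (Stieltjes), then the derivative of [I_R] would be at
    most [- c / x] for [x > 1]; if it were decreasing (strongly completely
    monotonic), the same would hold for [x < 1].  Either way [I_R] would be
    unbounded, while [0 <= I_R <= 1] ([logLaplace1_ge_div]).  For [n = 0],
    [x * I_R x] tends to 0 at 0 because [I_R <= 1], so it is not decreasing. *)

(** * The logarithmic density *)

(** The density of the measure whose Laplace transform is [I_R]. *)
Definition logdens (R : realType) (t : R) : R := (t * (pi ^+ 2 + ln t ^+ 2))^-1.

Lemma logdens_den_gt0 (R : realType) (a : R) : 0 < pi ^+ 2 + a ^+ 2 :> R.
Proof. by rewrite ltr_wpDr ?sqr_ge0// exprn_gt0// pi_gt0. Qed.

Lemma logdens_gt0 (R : realType) (t : R) : 0 < t -> 0 < logdens t.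
Proof. by move=> t0; rewrite invr_gt0 mulr_gt0// logdens_den_gt0. Qed.

Lemma continuous_logdens (R : realType) (t : R) : 0 < t ->
  {for t, continuous (@logdens R)}.
Proof.
move=> t0; have lnt := continuous_ln t0.
apply: cvgV; first by rewrite gt_eqF// mulr_gt0// logdens_den_gt0.
apply: cvgM; first exact: cvg_id.
apply: cvgD; first exact: cvg_cst.
by rewrite expr2; apply: cvgM; exact: lnt.
Qed.

Lemma measurable_logdens (R : realType) :
  measurable_fun (`]0%R, +oo[ : set R) (@logdens R).
Proof.
apply: open_continuous_measurable_fun; first exact: interval_open.
by move=> t; rewrite inE/= in_itv/= andbT => t0; exact: continuous_logdens.
Qed.

(** A primitive of [logdens] on the half-line. *)
Definition logdens_prim (R : realType) (t : R) : R := atan (ln t / pi) / pi.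

Lemma is_derive_logdens_prim (R : realType) (t : R) : 0 < t ->
  is_derive t 1 (@logdens_prim R) (logdens t).
Proof.
move=> t0; rewrite /logdens_prim.
have dln : is_derive t 1 (fun t : R => ln t / pi) (pi^-1 * t^-1).
  rewrite (_ : (fun t => _) = pi^-1 \*: @ln R); last first.
    by apply/funext => u; rewrite /= mulrC.
  exact: (is_deriveZ pi^-1 (is_derive1_ln t0)).
have datan := @is_derive1_comp _ _ (fun t : R => ln t / pi) _ _ _
  (is_derive1_atan _) dln.
rewrite (_ : (fun t => _) = pi^-1 \*: (@atan R \o (fun t : R => ln t / pi)));
  last by apply/funext => u; rewrite /= mulrC.
apply: (is_derive_eq (is_deriveZ pi^-1 datan)).
rewrite /logdens /GRing.scale/=.
have pi0 : pi != 0 :> R by rewrite gt_eqF// pi_gt0.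
have t1 : t != 0 by rewrite gt_eqF.
have den := lt0r_neq0 (logdens_den_gt0 (ln t)).
move: (pi : R) pi0 den => p pi0 den.
by field; rewrite t1 pi0 den.
Qed.

Lemma norm_logdens_prim (R : realType) (t : R) : `|logdens_prim t| <= 2^-1.
Proof.
have pi0 : 0 < pi :> R := pi_gt0 R.
rewrite /logdens_prim normrM normfV (gtr0_norm pi0) ler_pdivrMr//.
rewrite [leRHS]mulrC ler_norml; apply/andP; split; apply/ltW.
  exact: atan_gtNpi2.
exact: atan_ltpi2.
Qed.

(** The density has total mass at most [1] (in fact exactly [1]): its
    primitive [atan (ln t / pi) / pi] takes values between [-1/2] and [1/2]. *)
Lemma integral_logdens_le1 (R : realType) :
  (\int[@lebesgue_measure R]_(t in `]0%R, +oo[) (logdens t)%:E <= 1)%E.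
Proof.
(* Exhaust the half-line by segments [1 / (i + 2), i + 2]. *)
pose F (i : nat) : set R := `[i.+2%:R^-1, i.+2%:R].
have Fpos i (x : R) : F i x -> 0 < x.
  by rewrite /F/= in_itv/= => /andP[+ _]; apply: lt_le_trans; rewrite invr_gt0.
have -> : `]0%R, +oo[ = \bigcup_i F i.
  apply/seteqP; split => [x|x [i _ /Fpos]]; rewrite /= in_itv/= andbT// => x0.
  (* An integer above [x + 1 / x] bounds both [x] and [1 / x]. *)
  have [n hn] : exists n : nat, x + x^-1 <= n%:R.
    exists (Num.truncn (x + x^-1)).+1.
    exact/ltW/truncnS_gt.
  exists n => //; rewrite /F/= in_itv/=.
  have xi0 : 0 < x^-1 by rewrite invr_gt0.
  have n2 : n%:R <= n.+2%:R :> R.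
    by rewrite ler_nat; apply: leq_trans (leqnSn _).
  apply/andP; split; last by lra.
  by rewrite -[leRHS]invrK lef_pV2 ?posrE//; lra.
have cvF := @ge0_nondecreasing_set_cvg_integral _ (measurableTypeR R) _ F
  (fun t => (logdens t)%:E) lebesgue_measure.
apply: (cvge_to_le (cvF _ _ _ _)).
- move=> n m nm; rewrite subsetEset => x; rewrite /F/= !in_itv/= => /andP[a b].
  apply/andP; split.
    by apply: le_trans a; rewrite lef_pV2 ?posrE// ler_nat.
  by apply: (le_trans b); rewrite ler_nat.
- by move=> i; exact: measurable_itv.
- move=> i; apply/measurable_EFinP.
  apply: measurable_funS (@measurable_logdens R).
    exact: measurable_itv.
  by move=> x /Fpos; rewrite /= in_itv/= andbT.
- by move=> i x /Fpos x0; rewrite lee_fin ltW// logdens_gt0.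
apply: nearW => i.
have ii : (i.+2%:R^-1 < i.+2%:R :> R).
  by rewrite (@lt_trans _ _ 1)// ?invf_lt1 ?ltr1n// ltr0n.
have drv x : F i x -> derivable (@logdens_prim R) x 1.
  by move=> /Fpos x0; have [] := is_derive_logdens_prim x0.
rewrite (@continuous_FTC2 _ _ (@logdens_prim R))//.
- rewrite -EFinB lee_fin.
  have := norm_logdens_prim (i.+2%:R : R).
  have := norm_logdens_prim (i.+2%:R^-1 : R).
  by rewrite !ler_norml => /andP[a b] /andP[c d]; lra.
- apply: continuous_in_subspaceT => x; rewrite inE => /Fpos x0.
  exact: continuous_logdens.
- split.
  + move=> x xi; apply: drv; exact: subset_itv_oo_cc xi.
  + apply: cvg_at_right_filter; apply: differentiable_continuous.
    by apply/derivable1_diffP; apply: drv; rewrite /F/= in_itv/= lexx ltW.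
  + apply: cvg_at_left_filter; apply: differentiable_continuous.
    by apply/derivable1_diffP; apply: drv; rewrite /F/= in_itv/= lexx ltW.
- move=> x /subset_itv_oo_cc/Fpos x0.
  by rewrite derive1E (@derive_val _ _ _ _ _ _ _ (is_derive_logdens_prim x0)).
Qed.

Lemma integrable_logdens (R : realType) :
  (@lebesgue_measure R).-integrable `]0%R, +oo[ (EFin \o @logdens R).
Proof.
apply/integrableP; split.
  by apply/measurable_EFinP; exact: measurable_logdens.
apply: (@le_lt_trans _ _ 1%E); last by rewrite ltry.
apply: le_trans (@integral_logdens_le1 R).
rewrite le_eqVlt; apply/orP; left; apply/eqP; apply: eq_integral => t.
rewrite inE/= in_itv/= andbT => t0.
by rewrite /= ger0_norm// ltW// logdens_gt0.
Qed.

(** * Derivatives of the Laplace transform *)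

(** The exponential series bounds [(x * t) ^+ n / n`!] by [expR (x * t)]. *)
Lemma expRN_exprn_le (R : realType) (n : nat) (x t : R) : 0 < x -> 0 <= t ->
  expR (- (x * t)) * t ^+ n <= n`!%:R / x ^+ n.
Proof.
move=> x0 t0; rewrite expRN mulrC ler_pdivrMr ?expR_gt0//.
rewrite mulrAC ler_pdivlMr ?exprn_gt0//.
rewrite -exprMn (mulrC t) [leRHS]mulrC -ler_pdivrMr ?ltr0n ?fact_gt0//.
have xt0 : 0 <= x * t by rewrite mulr_ge0// ltW.
case: n => [|n]; first by rewrite expr0 fact0 mulr1n divr1 -expR0 ler_expR.
by apply: le_trans (expR_ge1Dxn n xt0); rewrite lerDr.
Qed.

(** The [n]-th moment integral: up to the sign [(-1) ^+ n], the [n]-th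
    derivative of [I_R]. *)
Definition logLaplace (R : realType) (n : nat) (x : R) : R :=
  \int[@lebesgue_measure R]_(t in `]0%R, +oo[)
    (expR (- (x * t)) * (t ^+ n * logdens t)).

Lemma measurable_logLaplace (R : realType) (n : nat) (x : R) :
  measurable_fun (`]0%R, +oo[ : set R)
    (fun t => expR (- (x * t)) * (t ^+ n * logdens t)).
Proof.
apply: measurable_funM.
  apply: measurable_funTS; apply: continuous_measurable_fun => t.
  apply: (@continuous_comp _ _ _ (fun t : R => - (x * t)) (@expR R)).
    by apply: cvgN; apply: cvgMr; exact: cvg_id.
  exact: continuous_expR.
apply: measurable_funM; last exact: measurable_logdens.
exact: measurable_funX.
Qed.

Lemma logLaplace_integrand_ge0 (R : realType) (n : nat) (x t : R) : 0 < t ->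
  0 <= expR (- (x * t)) * (t ^+ n * logdens t).
Proof.
move=> t0; rewrite mulr_ge0 ?expR_ge0//.
by rewrite mulr_ge0 ?exprn_ge0 ?ltW// logdens_gt0.
Qed.

(** This dominating function does not depend on [x >= u], as differentiation
    under the integral requires. *)
Lemma logLaplace_integrand_le (R : realType) (n : nat) (u x t : R) :
  0 < u -> u <= x -> 0 < t ->
  expR (- (x * t)) * (t ^+ n * logdens t) <= n`!%:R / u ^+ n * logdens t.
Proof.
move=> u0 ux t0; rewrite mulrA; apply: ler_wpM2r; first exact/ltW/logdens_gt0.
apply: le_trans (expRN_exprn_le n u0 (ltW t0)).
apply: ler_wpM2r; first exact/exprn_ge0/ltW.
by rewrite ler_expR lerN2; apply: ler_wpM2r; first exact/ltW.
Qed.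

Lemma integrable_logLaplace (R : realType) (n : nat) (x : R) : 0 < x ->
  (@lebesgue_measure R).-integrable `]0%R, +oo[
    (fun t => (expR (- (x * t)) * (t ^+ n * logdens t))%:E).
Proof.
move=> x0.
have mI : measurable (`]0%R, +oo[ : set (measurableTypeR R)).
  exact: measurable_itv.
have intC := integrableZl mI (n`!%:R / x ^+ n) (@integrable_logdens R).
apply: le_integrable intC => //.
  by apply/measurable_EFinP; exact: measurable_logLaplace.
move=> t; rewrite /= in_itv/= andbT => t0.
rewrite lee_fin ger0_norm ?logLaplace_integrand_ge0//.
by apply: le_trans (ler_norm _); exact: logLaplace_integrand_le.
Qed.

Lemma is_derive_logLaplace (R : realType) (n : nat) (x : R) : 0 < x ->
  is_derive x 1 (@logLaplace R n) (- logLaplace n.+1 x).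
Proof.
move=> x0.
have mI : measurable (`]0%R, +oo[ : set (measurableTypeR R)).
  exact: measurable_itv.
pose f (y t : R) := expR (- (y * t)) * (t ^+ n * logdens t).
have u0 : 0 < x / 2 by rewrite divr_gt0.
have Ix : `](x / 2), (x * 2)[%classic x.
  by rewrite /= in_itv/=; apply/andP; split; lra.
have df (y t : R) : is_derive y 1 (f ^~ t)
    (- (expR (- (y * t)) * (t ^+ n.+1 * logdens t))).
  have dN : is_derive y 1 (fun z : R => - (z * t)) (- t).
    have -> : (fun z : R => - (z * t)) = (- t) \*: (@id R).
      by apply/funext => z; rewrite /= /GRing.scale/= mulNr mulrC.
    apply: (is_derive_eq (is_deriveZ (- t) (is_derive_id _ _))).
    by rewrite /GRing.scale/= mulr1.
  have de := @is_derive1_comp _ _ (fun z : R => - (z * t)) _ _ _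
    (is_derive_expR _) dN.
  have -> : f ^~ t =
      (t ^+ n * logdens t) \*: (expR \o (fun z : R => - (z * t))).
    by apply/funext => z; rewrite /f /= /GRing.scale/= mulrC.
  apply: (is_derive_eq (is_deriveZ _ de)).
  by rewrite /GRing.scale/= exprS; ring.
have intf y : `](x / 2), (x * 2)[%classic y ->
    (@lebesgue_measure R).-integrable `]0%R, +oo[ (EFin \o f y).
  rewrite /= in_itv/= => /andP[y0 _].
  by apply: integrable_logLaplace; exact: lt_trans y0.
have derf1 y t : `](x / 2), (x * 2)[%classic y -> `]0%R, +oo[%classic t ->
  derivable (f ^~ t) y 1 by move=> _ _; have [] := df y t.
pose C := n.+1`!%:R / (x / 2) ^+ n.+1.
have C0 : 0 <= C by rewrite divr_ge0// exprn_ge0// ltW.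
(* The domination must be nonnegative on the whole line, hence the norm. *)
pose G (t : R) := C * `|logdens t|.
have G0 t : 0 <= G t by rewrite mulr_ge0.
have intG : (@lebesgue_measure R).-integrable `]0%R, +oo[ (EFin \o G).
  exact: (integrableZl mI C (integrable_norm (@integrable_logdens R))).
have d1E y t : partial1of2 f y t =
    - (expR (- (y * t)) * (t ^+ n.+1 * logdens t)).
  by rewrite partial1of2E (@derive_val _ _ _ _ _ _ _ (df y t)).
have G_ub y t : `](x / 2), (x * 2)[%classic y -> `]0%R, +oo[%classic t ->
    `|partial1of2 f y t| <= G t.
  rewrite /= !in_itv/= andbT => /andP[/ltW y0 _] t0.
  rewrite d1E normrN ger0_norm ?logLaplace_integrand_ge0// /G.
  rewrite (ger0_norm (ltW (logdens_gt0 t0))).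
  exact: logLaplace_integrand_le.
apply: DeriveDef.
  exact: (derivable_under_integral mI Ix intf derf1 G0 intG G_ub).
rewrite -derive1E.
rewrite (differentiation_under_integral mI Ix intf derf1 G0 intG G_ub).
rewrite /logLaplace -[RHS]mulN1r -RintegralZl//; last first.
  exact: integrable_logLaplace.
by apply: eq_Rintegral => t _; rewrite d1E mulN1r.
Qed.

(** The function [f] is arbitrary at nonpositive arguments: its iterated
    derivatives at positive points depend only on its values on the half-line. *)
Lemma derive1n_logLaplace (R : realType) (n k : nat) (c : R) (f : R -> R) :
  (forall x, 0 < x -> f x = c * logLaplace n x) ->
  forall x, 0 < x ->
    derive1n k f x = c * (-1) ^+ k * logLaplace (n + k) x /\
    derivable (derive1n k f) x 1.
Proof.
move=> fE.
have drv m (d : R) (g : R -> R) (x : R) : 0 < x ->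
    (forall x, 0 < x -> g x = d * logLaplace m x) ->
    is_derive x 1 g (- d * logLaplace m.+1 x).
  move=> x0 gE; apply: (@near_eq_is_derive _ _ _ (d \*: @logLaplace R m)).
    have /near_in_itvoy : x \in `]0, +oo[%R by rewrite in_itv/= x0.
    by apply: filterS => y /=; rewrite in_itv/= andbT => y0; rewrite gE.
  apply: (is_derive_eq (is_deriveZ d (is_derive_logLaplace m x0))).
  by rewrite /GRing.scale/= mulNr mulrN.
suff E x : 0 < x -> derive1n k f x = c * (-1) ^+ k * logLaplace (n + k) x.
  by move=> x x0; split; [exact: E|have [] := drv _ _ _ _ x0 E].
elim: k x => [|k IH] x x0; first by rewrite derive1n0 expr0 mulr1 addn0 fE.
rewrite derive1nS derive1E (@derive_val _ _ _ _ _ _ _ (drv _ _ _ _ x0 IH)).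
by rewrite addnS exprS; ring.
Qed.

Lemma I_RE (R : realType) : @I_R R = logLaplace 0.
Proof.
by apply/funext => x; apply: eq_Rintegral => t _; rewrite expr0 mul1r.
Qed.

Lemma derive1n_I_R (R : realType) (n : nat) (x : R) : 0 < x ->
  derive1n n (@I_R R) x = (-1) ^+ n * logLaplace n x /\
  derivable (derive1n n (@I_R R)) x 1.
Proof.
move=> x0; have := @derive1n_logLaplace R 0 n 1 (@I_R R) _ x x0.
by rewrite mul1r add0n; apply => y _; rewrite I_RE mul1r.
Qed.

Lemma I_R_sderE (R : realType) (n : nat) (x : R) : 0 < x ->
  I_R_sder n x = logLaplace n x.
Proof.
move=> x0; rewrite /I_R_sder (derive1n_I_R n x0).1 mulrA -exprD addnn.
by rewrite -mul2n exprM sqrrN expr1n expr1n mul1r.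
Qed.

Lemma logLaplaceE (R : realType) (n : nat) (x : R) : 0 < x ->
  ((logLaplace n x)%:E = \int[@lebesgue_measure R]_(t in `]0%R, +oo[)
     (expR (- (x * t)) * (t ^+ n * logdens t))%:E)%E.
Proof.
move=> x0; rewrite /logLaplace /Rintegral fineK//.
apply: integrable_fin_num; first exact: measurable_itv.
exact: integrable_logLaplace.
Qed.

Lemma logdens_exprzE (R : realType) (n : nat) (t : R) : 0 < t ->
  t ^+ n * logdens t = t ^ (n%:Z - 1) / (pi ^+ 2 + ln t ^+ 2).
Proof.
move=> t0; rewrite /logdens invfM expfzDr ?gt_eqF// mulrA.
by rewrite exprN1 -exprnP.
Qed.

(** * Strict monotonicity of [x ^+ k.+1 * logLaplace (n + k) x] *)

Lemma integral_gt0 (R : realType) (d : measure_display) (T : measurableType d)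
    (mu : {measure set T -> \bar R}) (D : set T) (f : T -> \bar R) :
  measurable D -> mu D != 0%E -> measurable_fun D f ->
  (forall x, D x -> 0 < f x)%E -> (0 < \int[mu]_(x in D) f x)%E.
Proof.
move=> mD muD mf f0.
rewrite lt0e integral_ge0 ?andbT; last by move=> x Dx; exact/ltW/f0.
apply: contra_neqN muD => /eqP If.
have : (\int[mu]_(x in D) `|f x| = 0)%E.
  rewrite -If; apply: eq_integral => x /set_mem Dx.
  by rewrite gee0_abs// ltW// f0.
move/(ae_eq_integral_abs mu mD mf) => [N [mN N0 DN]].
apply/eqP; rewrite -measure_le0 -N0; apply: le_measure; rewrite ?inE//.
move=> x Dx; apply: DN => /= /(_ Dx) fx0.
by have := f0 _ Dx; rewrite fx0 ltxx.
Qed.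

Lemma lt_integral (R : realType) (d : measure_display) (T : measurableType d)
    (mu : {measure set T -> \bar R}) (D : set T) (f g : T -> R) :
  measurable D -> mu D != 0%E -> measurable_fun D f -> measurable_fun D g ->
  (forall x, D x -> 0 <= f x) -> (forall x, D x -> f x < g x) ->
  (\int[mu]_(x in D) (f x)%:E < +oo)%E ->
  (\int[mu]_(x in D) (f x)%:E < \int[mu]_(x in D) (g x)%:E)%E.
Proof.
move=> mD muD mf mg f0 fg fy.
have -> : (\int[mu]_(x in D) (g x)%:E =
    \int[mu]_(x in D) (f x)%:E + \int[mu]_(x in D) (g x - f x)%:E)%E.
  rewrite -ge0_integralD//.
  - by apply: eq_integral => x _; rewrite -EFinD addrC subrK.
  - exact/measurable_EFinP.
  - by move=> x Dx; rewrite lee_fin subr_ge0 ltW// fg.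
  - by apply/measurable_EFinP; exact: measurable_funB.
rewrite lteDl; last by rewrite ge0_fin_numE// integral_ge0.
apply: integral_gt0 => //.
  by apply/measurable_EFinP; exact: measurable_funB.
by move=> x Dx; rewrite lte_fin subr_gt0 fg.
Qed.

Lemma lebesgue_measure_gt0_itv_neq0 (R : realType) :
  (@lebesgue_measure R) `]0%R, +oo[ != 0%E.
Proof. by rewrite lebesgue_measure_itv/= ltry. Qed.

(** The function [u / (pi ^+ 2 + ln u ^+ 2)] is increasing.  With
    [b = a * expR d] this follows from [expR d >= (1 + d / 2) ^+ 2] and [pi >= 2]. *)
Lemma lt_div_logsq (R : realType) (a b : R) : 0 < a -> a < b ->
  a / (pi ^+ 2 + ln a ^+ 2) < b / (pi ^+ 2 + ln b ^+ 2).
Proof.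
move=> a0 ab; have b0 : 0 < b := lt_trans a0 ab.
rewrite ltr_pdivrMr ?logdens_den_gt0// mulrAC ltr_pdivlMr ?logdens_den_gt0//.
set A := ln a; set B := ln b.
have -> : a = expR A by rewrite lnK.
have -> : b = expR B by rewrite lnK.
have AB : A < B by rewrite ltr_ln.
pose d := B - A.
have d0 : 0 < d by rewrite subr_gt0.
have BE : B = A + d by rewrite addrC subrK.
(* [1 + d <= expR d] alone is too weak for large [d]; its square at [d / 2]
   supplies the needed quadratic term. *)
have e1 : (1 + d / 2) ^+ 2 <= expR d.
  rewrite (_ : d = d / 2 + d / 2); last by rewrite -splitr.
  rewrite expRD -expr2 -splitr ler_sqr ?nnegrE ?expR_ge0//; last by lra.
  exact: expR_ge1Dx.
rewrite BE expRD -mulrA ltr_pM2l ?expR_gt0//.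
have p4 : 4 <= pi ^+ 2 :> R by have := @pi_ge2 R; nra.
move: (pi ^+ 2 : R) p4 => p p4.
apply: (@lt_le_trans _ _ ((1 + d / 2) ^+ 2 * (p + A ^+ 2))); last first.
  by apply: ler_wpM2r => //; rewrite addr_ge0 ?sqr_ge0//; lra.
rewrite -subr_gt0.
have -> : (1 + d / 2) ^+ 2 * (p + A ^+ 2) - (p + (A + d) ^+ 2) =
  d * ((A - 1) ^+ 2 + (p - 1)) + d ^+ 2 / 4 * (A ^+ 2 + (p - 4)) by field.
apply: ltr_wpDr.
  by rewrite mulr_ge0 ?divr_ge0 ?sqr_ge0// addr_ge0 ?sqr_ge0//; lra.
by rewrite mulr_gt0// ltr_wpDl ?sqr_ge0//; lra.
Qed.

Lemma lt_expr_logdens (R : realType) (n : nat) (a b : R) : 0 < a -> a < b ->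
  a ^+ n.+2 * logdens a < b ^+ n.+2 * logdens b.
Proof.
move=> a0 ab; have b0 : 0 < b := lt_trans a0 ab.
have E (u : R) : 0 < u -> u ^+ n.+2 * logdens u =
    u ^+ n * (u / (pi ^+ 2 + ln u ^+ 2)).
  move=> u0; rewrite /logdens invfM !exprS.
  have u1 : u != 0 by rewrite gt_eqF.
  by move: (_ + _)^-1 (u ^+ n) => s r; field.
rewrite !E//; apply: (@le_lt_trans _ _ (b ^+ n * (a / (pi ^+ 2 + ln a ^+ 2)))).
  apply: ler_wpM2r; first by rewrite divr_ge0// ltW// logdens_den_gt0.
  by rewrite lerXn2r ?nnegrE ?ltW.
by rewrite ltr_pM2l ?exprn_gt0// lt_div_logsq.
Qed.

(** This bound gives the continuity at 0 of the integrands below. *)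
Lemma expr_logdens_le (R : realType) (n : nat) (u : R) : 0 < u -> u <= 1 ->
  u ^+ n.+2 * logdens u <= u.
Proof.
move=> u0 u1; rewrite /logdens ler_pdivrMr ?mulr_gt0 ?logdens_den_gt0//.
have d1 : 1 <= pi ^+ 2 + ln u ^+ 2 :> R.
  by have := @pi_ge2 R; have := sqr_ge0 (ln u); nra.
apply: (@le_trans _ _ (u ^+ 2)); first by apply: ler_wiXn2l => //; exact: ltW.
by rewrite expr2 ler_pM2l// ler_peMr// ltW.
Qed.

(** Invariance of the integral over the half-line under dilations. *)
Lemma ge0_integral_dilation (R : realType) (x : R) (G : R -> R) : 0 < x ->
  {within `[0%R, +oo[, continuous G} -> (forall t, 0 < t -> 0 <= G t) ->
  (\int[@lebesgue_measure R]_(t in `]0%R, +oo[) (G t)%:E =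
   \int[@lebesgue_measure R]_(t in `]0%R, +oo[) (x * G (x * t))%:E)%E.
Proof.
move=> x0 cG G0.
have [cG' _] := (continuous_within_itvcyP 0 G).1 cG.
have dF (t : R) : is_derive t 1 ( *%R x) x.
  have -> : *%R x = x \*: (@id R) by [].
  apply: (is_derive_eq (is_deriveZ x (is_derive_id _ _))).
  by rewrite /GRing.scale/= mulr1.
have F'E : ( *%R x)^`() = cst x.
  by apply/funext => t; rewrite derive1E (@derive_val _ _ _ _ _ _ _ (dF t)).
have cF (t : R) : x * s @[s --> t] --> x * t by apply: cvgMr; exact: cvg_id.
have cGF (t : R) : 0 < t -> {for t, continuous (fun s => x * G (x * s))}.
  move=> t0; apply: cvgMr; apply: (@cvg_comp _ _ _ ( *%R x) G); first exact: cF.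
  by apply: cG'; rewrite in_itv/= andbT mulr_gt0.
rewrite [LHS]integral_itv_obnd_cbnd; last first.
  apply/measurable_EFinP; apply: open_continuous_measurable_fun => //.
  by move=> t; rewrite inE => tI; exact: cG'.
rewrite [RHS]integral_itv_obnd_cbnd; last first.
  apply/measurable_EFinP; apply: open_continuous_measurable_fun => //.
  by move=> t; rewrite inE/= in_itv/= andbT => t0; exact: cGF.
have := @increasing_ge0_integration_by_substitutiony R ( *%R x) G 0.
rewrite mulr0 F'E => ->//.
- by apply: eq_integral => t _; rewrite !fctE mulrC.
- by move=> s t _ _ st; rewrite ltr_pM2l.
- by move=> t _; exact: cvg_cst.
- exact: is_cvg_cst.
- exact: is_cvg_cst.
- split; first by move=> t _; have [] := dF t.
  by apply: cvg_at_right_filter; exact: cF.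
- exact: gt0_cvgMry.
- by move=> t; rewrite in_itv/= andbT; exact: G0.
Qed.

(** The integrand of [x ^+ k.+1 * logLaplace (n.+2 + k) x] after the change of
    variables [s = x * t]; [x] occurs in it only through the increasing function
    [u ^+ n.+2 * logdens u] of [u = s / x]. *)
Definition dilated_integrand (R : realType) (n k : nat) (x s : R) : R :=
  expR (- s) * s ^+ k * ((s / x) ^+ n.+2 * logdens (s / x)).

Lemma dilated_integrand_ge0 (R : realType) (n k : nat) (x s : R) :
  0 < x -> 0 < s -> 0 <= dilated_integrand n k x s.
Proof.
move=> x0 s0; have sx : 0 < s / x by rewrite divr_gt0.
apply: mulr_ge0; apply: mulr_ge0; rewrite ?expR_ge0 ?exprn_ge0 ?(ltW s0)//.
  exact: ltW.
exact/ltW/logdens_gt0.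
Qed.

Lemma continuous_dilated_integrand (R : realType) (n k : nat) (x s : R) :
  0 < x -> 0 < s -> {for s, continuous (dilated_integrand n k x)}.
Proof.
move=> x0 s0; have sx : 0 < s / x by rewrite divr_gt0.
have csx : t / x @[t --> s] --> s / x by apply: cvgMl; exact: cvg_id.
apply: cvgM.
  apply: cvgM; last exact: exprn_continuous.
  apply: (@cvg_comp _ _ _ (fun t : R => - t) (@expR R)).
    by apply: cvgN; exact: cvg_id.
  exact: continuous_expR.
apply: cvgM.
  apply: (@cvg_comp _ _ _ (fun t : R => t / x) (fun t => t ^+ n.+2) _ _ _ csx).
  exact: exprn_continuous.
apply: (@cvg_comp _ _ _ (fun t : R => t / x) (@logdens R) _ _ _ csx).
exact: continuous_logdens.
Qed.

Lemma within_continuous_dilated_integrand (R : realType) (n k : nat) (x : R) :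
  0 < x -> {within `[0%R, +oo[, continuous (dilated_integrand n k x)}.
Proof.
move=> x0; apply/continuous_within_itvcyP; split.
  move=> s; rewrite in_itv/= andbT => s0.
  exact: continuous_dilated_integrand.
have -> : dilated_integrand n k x 0 = 0.
  by rewrite /dilated_integrand mul0r exprS !mul0r mulr0.
apply: (@squeeze_cvgr _ _ _ _ (cst 0) (fun s : R => s / x)).
- near=> s.
  have s0 : 0 < s by near: s; exact: nbhs_right_gt.
  have s1 : s < 1 by near: s; exact: nbhs_right_lt.
  have sx1 : s < x by near: s; exact: nbhs_right_lt.
  have sx : 0 < s / x by rewrite divr_gt0.
  rewrite /= dilated_integrand_ge0//= -[leRHS]mul1r; apply: ler_pM.
  + by rewrite mulr_ge0 ?expR_ge0// exprn_ge0// ltW.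
  + by rewrite mulr_ge0 ?exprn_ge0 ?(ltW sx)//; exact/ltW/logdens_gt0.
  + apply: mulr_ile1; rewrite ?expR_ge0 ?exprn_ge0 ?(ltW s0)//.
      by rewrite expR_le1 oppr_le0 ltW.
    by rewrite exprn_ile1 ?(ltW s0) ?(ltW s1).
  + by apply: expr_logdens_le => //; rewrite ler_pdivrMr// mul1r ltW.
- exact: cvg_cst.
- apply: cvg_at_right_filter.
  have cdiv : s / x @[s --> (0 : R)] --> 0 / x by apply: cvgMl; exact: cvg_id.
  by rewrite mul0r in cdiv.
Unshelve. all: by end_near. Qed.

Lemma logLaplace_dilation (R : realType) (n k : nat) (x : R) : 0 < x ->
  ((x ^+ k.+1 * logLaplace (n.+2 + k) x)%:E =
   \int[@lebesgue_measure R]_(s in `]0%R, +oo[)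
     (dilated_integrand n k x s)%:E)%E.
Proof.
move=> x0; rewrite (ge0_integral_dilation x0); last 2 first.
- exact: within_continuous_dilated_integrand.
- by move=> t; exact: dilated_integrand_ge0.
rewrite EFinM logLaplaceE// -ge0_integralZl_EFin ?exprn_ge0 ?ltW//.
- apply: eq_integral => t; rewrite inE/= in_itv/= andbT => t0.
  rewrite -EFinM /dilated_integrand; congr EFin.
  have -> : x * t / x = t by rewrite mulrAC divff ?gt_eqF// mul1r.
  by rewrite exprMn exprS exprD; ring.
- move=> t; rewrite /= in_itv/= andbT => t0.
  by rewrite lee_fin logLaplace_integrand_ge0.
- by apply/measurable_EFinP; exact: measurable_logLaplace.
Qed.

Lemma lt_exprM_logLaplace (R : realType) (n k : nat) (x y : R) :
  0 < x -> x < y ->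
  y ^+ k.+1 * logLaplace (n.+2 + k) y < x ^+ k.+1 * logLaplace (n.+2 + k) x.
Proof.
move=> x0 xy; have y0 : 0 < y := lt_trans x0 xy.
have mI (z : R) : 0 < z ->
    measurable_fun (`]0%R, +oo[ : set R) (dilated_integrand n k z).
  move=> z0; apply: open_continuous_measurable_fun; first exact: interval_open.
  move=> s; rewrite inE/= in_itv/= andbT => s0.
  exact: continuous_dilated_integrand.
rewrite -lte_fin !logLaplace_dilation//; apply: lt_integral.
- exact: measurable_itv.
- exact: lebesgue_measure_gt0_itv_neq0.
- exact: mI.
- exact: mI.
- by move=> s; rewrite /= in_itv/= andbT; exact: dilated_integrand_ge0.
- move=> s; rewrite /= in_itv/= andbT => s0.
  rewrite ltr_pM2l; last by rewrite mulr_gt0 ?expR_gt0// exprn_gt0.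
  apply: lt_expr_logdens; first by rewrite divr_gt0.
  by rewrite ltr_pM2l// ltf_pV2.
- by rewrite -logLaplace_dilation// ltry.
Qed.

(** * Stieltjes functions and the logarithmic growth obstruction *)

Lemma strongly_completely_monotonic_decr (R : realType) (f : R -> R) (x y : R) :
  strongly_completely_monotonic f -> 0 < x -> x < y -> y * f y < x * f x.
Proof.
move=> [_ /(_ 0%N)/= [_ fd]] x0 xy.
by have := fd x y x0 xy; rewrite !expr0 !expr1 !mul1r.
Qed.

(** After multiplication by [x], each term [a], [b * x] and [x / (x + t)] of the
    Stieltjes representation is nondecreasing in [x]. *)
Lemma stieltjes_mul_nondecreasing (R : realType) (f : R -> R) (x y : R) :
  stieltjes_function f -> 0 < x -> x <= y -> x * f x <= y * f y.
Proof.
move=> [_ [a [b [mu [a0 b0 _ fE]]]]] x0 xy.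
have y0 : 0 < y := lt_le_trans x0 xy.
pose D : set (measurableTypeR R) := `]0%R, +oo[.
have mD : measurable D by exact: measurable_itv.
have pos (z t : R) : 0 < z -> D t -> 0 < z + t.
  by rewrite /D/= in_itv/= andbT => *; rewrite addr_gt0.
have mf (z : R) : 0 < z -> measurable_fun D (fun t : R => ((z + t)^-1)%:E).
  move=> z0; apply/measurable_EFinP.
  apply: open_continuous_measurable_fun; first exact: interval_open.
  move=> t; rewrite inE => Dt; apply: cvgV; first by rewrite gt_eqF// pos.
  by apply: cvgD; [exact: cvg_cst|exact: cvg_id].
have f0 (z t : R) : 0 < z -> D t -> (0 <= ((z + t)^-1)%:E)%E.
  by move=> z0 Dt; rewrite lee_fin invr_ge0 ltW// pos.
pose J (z : R) := (\int[mu]_(t in D) ((z + t)^-1)%:E)%E.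
have J0 z : 0 < z -> (0 <= J z)%E.
  by move=> z0; apply: integral_ge0 => t; exact: f0.
(* [f z] is a real number, so the integral representing it is finite. *)
have Jfin z : 0 < z -> J z = (fine (J z))%:E.
  move=> z0; rewrite fineK// ge0_fin_numE ?J0// ltey; apply/eqP => Jy.
  by have := fE z z0; rewrite -/(J z) Jy addey.
have le_J : x * fine (J x) <= y * fine (J y).
  have ZJ z : 0 < z ->
      ((z * fine (J z))%:E = \int[mu]_(t in D) (z * (z + t)^-1)%:E)%E.
    move=> z0; rewrite EFinM -Jfin// -ge0_integralZl_EFin//.
    - by move=> t; exact: f0.
    - exact: mf.
    - exact: ltW.
  have mzf (z : R) : 0 < z ->
      measurable_fun D (fun t : R => (z * (z + t)^-1)%:E).
    move=> z0; under eq_fun do rewrite EFinM.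
    by apply: measurable_funeM; exact: mf.
  rewrite -lee_fin !ZJ//.
  apply: ge0_le_integral => //; [|exact: mzf|exact: mzf|].
    by move=> t Dt; rewrite lee_fin mulr_ge0 ?(ltW x0) ?invr_ge0 ?ltW ?pos.
  move=> t Dt; have t0 : 0 < t by move: Dt; rewrite /D/= in_itv/= andbT.
  rewrite lee_fin ler_pdivrMr ?pos// mulrAC ler_pdivlMr ?pos//.
  by rewrite !mulrDr (mulrC y x) lerD2l ler_pM2r.
have fJ z : 0 < z -> z * f z = a + b * z + z * fine (J z).
  move=> z0; have := fE z z0; rewrite -/(J z) Jfin// -!EFinD => -[->].
  by rewrite !mulrDr mulrCA divff ?gt_eqF// mulr1 (mulrC z b).
by rewrite !fJ// lerD// lerD2l ler_wpM2l.
Qed.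

Lemma logLaplace_ge0 (R : realType) (n : nat) (x : R) : 0 <= logLaplace n x.
Proof.
apply: Rintegral_ge0 => t; rewrite /= in_itv/= andbT.
exact: logLaplace_integrand_ge0.
Qed.

Lemma logLaplace_gt0 (R : realType) (n : nat) (x : R) : 0 < x ->
  0 < logLaplace n x.
Proof.
move=> x0; rewrite -lte_fin logLaplaceE//; apply: integral_gt0.
- exact: measurable_itv.
- exact: lebesgue_measure_gt0_itv_neq0.
- by apply/measurable_EFinP; exact: measurable_logLaplace.
- move=> t; rewrite /= in_itv/= andbT => t0.
  by rewrite lte_fin !mulr_gt0 ?expR_gt0 ?exprn_gt0 ?logdens_gt0.
Qed.

Lemma logLaplace0_le1 (R : realType) (x : R) : 0 < x -> logLaplace 0 x <= 1.
Proof.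
move=> x0; rewrite -lee_fin logLaplaceE//.
apply: le_trans (@integral_logdens_le1 R); apply: ge0_le_integral.
- exact: measurable_itv.
- move=> t; rewrite /= in_itv/= andbT => t0.
  by rewrite lee_fin logLaplace_integrand_ge0.
- by apply/measurable_EFinP; exact: measurable_logLaplace.
- by apply/measurable_EFinP; exact: measurable_logdens.
- move=> t; rewrite /= in_itv/= andbT => t0.
  rewrite lee_fin expr0 mul1r ler_piMl ?(ltW (logdens_gt0 t0))//.
  by rewrite expR_le1 oppr_le0 mulr_ge0// ltW.
Qed.

(** If [- I_R'] dominates [c / x] on an interval, then [I_R] drops by at least
    [c * (ln b - ln a)] across it; but [I_R] has values between 0 and 1. *)
Lemma logLaplace1_ge_div (R : realType) (c a b : R) : 0 < a -> a < b ->
  (forall x, a < x < b -> c / x <= logLaplace 1 x) -> c * (ln b - ln a) <= 1.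
Proof.
move=> a0 ab L1.
pose h := @logLaplace R 0 + (c \*: @ln R).
have dh (x : R) : 0 < x -> is_derive x 1 h (- logLaplace 1 x + c *: x^-1).
  move=> x0.
  apply: (is_deriveD (is_derive_logLaplace 0 x0)).
  exact: (is_deriveZ c (is_derive1_ln x0)).
pose dhdx (x : R) : R := - logLaplace 1 x + c *: x^-1.
have h_in (x : R) : x \in `[a, b]%R -> 0 < x.
  by rewrite in_itv/= => /andP[+ _]; exact: lt_le_trans.
have [z zab hE] : exists2 z, z \in `]a, b[%R &
    h b - h a = dhdx z * (b - a).
  apply: MVT ab _ _.
    by move=> x /subset_itv_oo_cc/h_in; exact: dh.
  by apply: derivable_within_continuous => x /h_in x0; have [] := dh x x0.
have hba : h b - h a <= 0.
  rewrite hE; apply: mulr_le0_ge0; last by rewrite subr_ge0 ltW.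
  by rewrite /dhdx addrC subr_le0; apply: L1; move: zab; rewrite in_itv.
have hx (x : R) : h x = logLaplace 0 x + c * ln x by [].
have := logLaplace_ge0 0 b; have := logLaplace0_le1 a0.
move: hba; rewrite !hx mulrBr.
move: (logLaplace 0 a) (logLaplace 0 b) (c * ln a) (c * ln b) => p q r s.
lra.
Qed.

Theorem theorem5 (R : realType) :
  (forall (n : nat) (x : R), 0 < x ->
     derivable (derive1n n (@I_R R)) x 1 /\
     ((I_R_sder n x)%:E =
        \int[@lebesgue_measure R]_(t in `]0%R, +oo[)
          (expR (- (x * t)) * (t ^ (n%:Z - 1) / (pi ^+ 2 + ln t ^+ 2)))%:E)%E) /\
  (forall n : nat, (2 <= n)%N ->
     strongly_completely_monotonic (@I_R_sder R n) /\
     ~ stieltjes_function (@I_R_sder R n)) /\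
  (~ strongly_completely_monotonic (fun x : R => - derive1 (@I_R R) x) /\
   ~ stieltjes_function (fun x : R => - derive1 (@I_R R) x)) /\
  ~ strongly_completely_monotonic (@I_R R).
Proof.
split; [|split; [|split]].
- move=> n x x0; split; first by have [] := derive1n_I_R n x0.
  rewrite I_R_sderE// logLaplaceE//; apply: eq_integral => t.
  by rewrite inE/= in_itv/= andbT => t0; rewrite logdens_exprzE.
- move=> [|[|n]] // _; split.
    have fE := @derive1n_logLaplace R n.+2 _ 1 (@I_R_sder R n.+2).
    have {}fE k x (x0 : 0 < x) := fE k
      (fun z z0 => etrans (I_R_sderE n.+2 z0) (esym (mul1r _))) x x0.
    have gE k (x : R) : 0 < x ->
        (-1) ^+ k * x ^+ k.+1 * derive1n k (@I_R_sder R n.+2) x =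
        x ^+ k.+1 * logLaplace (n.+2 + k) x.
      move=> x0; rewrite (fE k x x0).1 mul1r mulrACA -exprD addnn.
      by rewrite -mul2n exprM sqrrN !expr1n mul1r.
    split => [k x x0|k g]; first exact: (fE k x x0).2.
    split => [x x0|x y x0 xy]; rewrite /g !gE//.
    + by rewrite mulr_ge0 ?logLaplace_ge0// exprn_ge0// ltW.
    + exact: lt_exprM_logLaplace.
    + exact: lt_trans xy.
  move=> /stieltjes_mul_nondecreasing/(_ (ltr01 : 0 < 1 :> R)).
  move=> /(_ 2 (ltW _)); rewrite ltr1n => /(_ isT).
  apply/negP; rewrite -ltNge !I_R_sderE//.
  have := @lt_exprM_logLaplace R n 0 1 2 ltr01.
  by rewrite addn0 !expr1 ltr1n; exact.
- pose f : R -> R := fun x => - derive1 (@I_R R) x.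
  have fE (x : R) : 0 < x -> f x = logLaplace 1 x.
    move=> x0; rewrite /f -(I_R_sderE 1 x0) /I_R_sder.
    by rewrite expr1 mulN1r derive1n1.
  (* From here on only the values of [f] at positive arguments matter. *)
  rewrite -/f; clearbody f.
  split => S.
  - have gc (x : R) : 0 < x -> x < 1 -> logLaplace 1 1 < x * logLaplace 1 x.
      move=> x0 x1; have := strongly_completely_monotonic_decr S x0 x1.
      by rewrite mul1r !fE.
    have := @logLaplace_gt0 R 1 1 ltr01.
    move: (logLaplace 1 1 : R) gc => c gc c0.
    (* On the interval from [expR (- (2 / c))] to 1, the lower bound [c / x]
       makes [I_R] vary by at least 2. *)
    have e0 : expR (- (2 / c)) < 1 by rewrite expR_lt1 oppr_lt0 divr_gt0.
    have := @logLaplace1_ge_div R c _ 1 (expR_gt0 _) e0.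
    rewrite ln1 sub0r expRK opprK mulrCA divff ?gt_eqF// mulr1 => H.
    suff : 2 <= 1 :> R by apply/negP; rewrite -ltNge ltr1n.
    apply: H => x /andP[ex x1]; have x0 := lt_trans (expR_gt0 _) ex.
    by rewrite ler_pdivrMr// mulrC ltW// gc.
  - have gc (x : R) : 1 < x -> logLaplace 1 1 <= x * logLaplace 1 x.
      move=> x1; have := stieltjes_mul_nondecreasing S ltr01 (ltW x1).
      by rewrite mul1r !fE// (lt_trans ltr01).
    have := @logLaplace_gt0 R 1 1 ltr01.
    move: (logLaplace 1 1 : R) gc => c gc c0.
    (* Likewise on the interval from 1 to [expR (2 / c)]. *)
    have e0 : 1 < expR (2 / c) by rewrite expR_gt1 divr_gt0.
    have := @logLaplace1_ge_div R c 1 _ ltr01 e0.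
    rewrite ln1 subr0 expRK mulrCA divff ?gt_eqF// mulr1 => H.
    suff : 2 <= 1 :> R by apply/negP; rewrite -ltNge ltr1n.
    apply: H => x /andP[x1 _]; have x0 := lt_trans ltr01 x1.
    by rewrite ler_pdivrMr// mulrC gc.
- move=> S.
  have gc (x : R) : 0 < x -> x < 1 -> logLaplace 0 1 < x * logLaplace 0 x.
    move=> x0 x1; have := strongly_completely_monotonic_decr S x0 x1.
    by rewrite mul1r I_RE.
  have := @logLaplace0_le1 R 1 ltr01; have := @logLaplace_gt0 R 0 1 ltr01.
  move: (logLaplace 0 1 : R) gc => c gc c0 c1.
  (* At [c / 2] the product [x * I_R x] is at most [c / 2], not above [c]. *)
  have x0 : 0 < c / 2 by rewrite divr_gt0.
  have x1 : c / 2 < 1 by lra.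
  have := gc _ x0 x1; have := logLaplace0_le1 x0.
  move: (logLaplace _ _ : R) => l l1 cl.
  suff : c < c / 2 by lra.
  by apply: (lt_le_trans cl); rewrite ler_piMr// ltW.
Qed.
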